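(* Let $G$ be a finite group and $\omega\in Z^3_{\mathrm{gp}}(G,U(1))$. The representation group of the twisted Drinfeld double of $G$ decomposes as the direct sum of twisted representation groups of the centralizers of the conjugacy classes of $G$: $$\mathrm{Rep}(D^\omega(G))\cong\bigoplus_{[x]\subset G}\mathrm{Rep}^{\tau(\omega)|_x}(C_x),$$ where $x$ runs over one representative from each conjugacy class of $G$.
   Context: Three-cocycles. $\omega\in Z^3_{\mathrm{gp}}(G,U(1))$ is a function $G^3\to U(1)$, normalized ($\omega=1$ if any argument is $e$), with $\omega(h,g,f)\,\omega(kh,g,f)^{-1}\,\omega(k,hg,f)\,\omega(k,h,gf)^{-1}\,\omega(k,h,g)=1$ for all $k,h,g,f\in G$. Twisted Drinfeld double. $D^\omega(G)$ (as an algebra) is the complex algebra with basis $\{\langle\xleftarrow{g}x\rangle : g,x\in G\}$ and product $$\langle\xleftarrow{h}y\rangle\cdot\langle\xleftarrow{g}x\rangle:=\delta_{y,gxg^{-1}}\frac{\omega(h,g,x)\,\omega(hgx(hg)^{-1},h,g)}{\omega(h,gxg^{-1},g)}\langle\xleftarrow{hg}x\rangle;$$ its unit is $\sum_x\langle\xleftarrow{e}x\rangle$. $\mathrm{Rep}(D^\omega(G))$ is the Grothendieck group of its finite-dimensional (unital) complex representations. Centralizers and cocycles. $C_x$ is the centralizer of $x$ in $G$. $\tau(\omega)|_x\in Z^2_{\mathrm{gp}}(C_x,U(1))$ is the restriction to $C_x$ of the loop transgression of $\omega$, explicitly $\tau(\omega)|_x(h,g)=\frac{\omega(h,g,x)\,\omega(x,h,g)}{\omega(h,x,g)}$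 for $h,g\in C_x$. Twisted representations. For a finite group $H$ with normalized two-cocycle $\psi\in Z^2_{\mathrm{gp}}(H,U(1))$, a $\psi$-twisted representation is a map $\rho\colon H\to\mathrm{End}(V)$, $V$ a finite-dimensional complex vector space, with $\rho(e)=1$ and $\rho(h)\rho(g)=\psi(h,g)\rho(hg)$. $\mathrm{Rep}^\psi(H)$ is the Grothendieck group of the category of $\psi$-twisted representations (morphisms being linear maps commuting with the actions). *)

(* Defs.v *)
From HB Require Import structures.
From mathcomp Require Import all_boot all_order all_algebra all_fingroup.
From mathcomp Require Import boolp reals complex freeg.

Set Implicit Arguments.
Unset Strict Implicit.
Unset Printing Implicit Defensive.

Import GRing.Theory Num.Theory.

Local Open Scope ring_scope.
Local Open Scope complex_scope.

Record cocycle2 (R : realType) (H : finGroupType) := Cocycle2 {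
  cocycle2_fun :> H -> H -> R[i];
  cocycle2_norm : forall h g, `|cocycle2_fun h g| = 1;
  cocycle2_1l : forall g, cocycle2_fun 1%g g = 1;
  cocycle2_1r : forall h, cocycle2_fun h 1%g = 1;
  cocycle2_closed : forall k h g,
    cocycle2_fun h g * (cocycle2_fun (k * h)%g g)^-1
      * cocycle2_fun k (h * g)%g * (cocycle2_fun k h)^-1 = 1
}.

Record cocycle3 (R : realType) (G : finGroupType) := Cocycle3 {
  cocycle3_fun :> G -> G -> G -> R[i];
  cocycle3_norm : forall h g f, `|cocycle3_fun h g f| = 1;
  cocycle3_1l : forall g f, cocycle3_fun 1%g g f = 1;
  cocycle3_1m : forall h f, cocycle3_fun h 1%g f = 1;
  cocycle3_1r : forall h g, cocycle3_fun h g 1%g = 1;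
  cocycle3_closed : forall k h g f,
    cocycle3_fun h g f * (cocycle3_fun (k * h)%g g f)^-1
      * cocycle3_fun k (h * g)%g f * (cocycle3_fun k h (g * f)%g)^-1
      * cocycle3_fun k h g = 1
}.

(* [ses a b c] is meant as "there is a short exact sequence 0 -> a -> b -> c
   -> 0"; the resulting relations are [b] = [a] + [c]. *)
Section Grothendieck.
Variables (Ob : Type) (ses : Ob -> Ob -> Ob -> Prop).

Definition K0_free : zmodType := {freeg {classic Ob} / int}.

Inductive K0_rel : K0_free -> Prop :=
| K0_rel_ses (a b c : {classic Ob}) of ses a b c : K0_rel (<<b>> - <<a>> - <<c>>)
| K0_rel_0 : K0_rel 0
| K0_rel_B u v of K0_rel u & K0_rel v : K0_rel (u - v).

Definition K0_relb : {pred K0_free} := fun u => `[< K0_rel u >].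

Fact K0_relb_zmod_closed : zmod_closed K0_relb.
Proof.
split; first by apply/asboolP; exact: K0_rel_0.
by move=> u v /asboolP Hu /asboolP Hv; apply/asboolP; exact: K0_rel_B.
Qed.

HB.instance Definition _ :=
  GRing.isZmodClosed.Build K0_free K0_relb K0_relb_zmod_closed.

Definition K0 : zmodType := Quotient.quot K0_relb.

End Grothendieck.

(* The index type is finite, so the direct sum is the product. *)
Section DirectSum.
Variables (I : finType) (A : I -> zmodType).

Definition dsum := {dffun forall i, A i}.

HB.instance Definition _ := Choice.on dsum.

Implicit Types f g h : dsum.

Definition dsum_add f g : dsum := [ffun i => f i + g i].
Definition dsum_opp f : dsum := [ffun i => - f i].
Definition dsum_zero : dsum := [ffun i => 0].

Fact dsum_addA : associative dsum_add.
Proof. by move=> f g h; apply/ffunP => i; rewrite !ffunE addrA. Qed.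
Fact dsum_addC : commutative dsum_add.
Proof. by move=> f g; apply/ffunP => i; rewrite !ffunE addrC. Qed.
Fact dsum_add0 : left_id dsum_zero dsum_add.
Proof. by move=> f; apply/ffunP => i; rewrite !ffunE add0r. Qed.
Fact dsum_addN : left_inverse dsum_zero dsum_opp dsum_add.
Proof. by move=> f; apply/ffunP => i; rewrite !ffunE addNr. Qed.

HB.instance Definition _ :=
  GRing.isZmodule.Build dsum dsum_addA dsum_addC dsum_add0 dsum_addN.

End DirectSum.

Definition intertwines (F : fieldType) (S : Type) (U V : vectType F)
    (rU : S -> 'End(U)) (rV : S -> 'End(V)) (f : 'Hom(U, V)) :=
  forall s, (f \o rU s)%VF = (rV s \o f)%VF.

Definition short_exact (F : fieldType) (U V W : vectType F)
    (f : 'Hom(U, V)) (g : 'Hom(V, W)) :=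
  [/\ lker f = 0%VS, limg f = lker g & limg g = fullv].

(* Every finite-dimensional space is isomorphic to some F^n, so restricting the
   underlying spaces to these does not change the Grothendieck group.  Letting
   them range over [vectType F] would make the type of representations too large
   to generate a [zmodType]. *)
Record alg_rep (F : fieldType) (A : algType F) := AlgRep {
  alg_rep_dim : nat;
  alg_rep_act : A -> 'End('cV[F]_alg_rep_dim);
  alg_rep_linear : linear alg_rep_act;
  alg_rep1 : alg_rep_act 1 = \1%VF;
  alg_repM : forall a b,
    alg_rep_act (a * b) = (alg_rep_act a \o alg_rep_act b)%VF
}.

Definition alg_rep_ses (F : fieldType) (A : algType F) (U V W : alg_rep A) :=
  exists (f : 'Hom('cV[F]_(alg_rep_dim U), 'cV[F]_(alg_rep_dim V)))
         (g : 'Hom('cV[F]_(alg_rep_dim V), 'cV[F]_(alg_rep_dim W))),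
    [/\ intertwines (@alg_rep_act F A U) (@alg_rep_act F A V) f,
        intertwines (@alg_rep_act F A V) (@alg_rep_act F A W) g
      & short_exact f g].

Definition Rep (F : fieldType) (A : algType F) : zmodType :=
  K0 (@alg_rep_ses F A).

Section TwistedRepresentations.
Variables (R : realType) (H : finGroupType) (psi : cocycle2 R H).

Record tw_rep := TwRep {
  tw_rep_dim : nat;
  tw_rep_act : H -> 'End('cV[R[i]]_tw_rep_dim);
  tw_rep1 : tw_rep_act 1%g = \1%VF;
  tw_repM : forall h g,
    (tw_rep_act h \o tw_rep_act g)%VF = psi h g *: tw_rep_act (h * g)%g
}.

Definition tw_rep_ses (U V W : tw_rep) :=
  exists (f : 'Hom('cV[R[i]]_(tw_rep_dim U), 'cV[R[i]]_(tw_rep_dim V)))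
         (g : 'Hom('cV[R[i]]_(tw_rep_dim V), 'cV[R[i]]_(tw_rep_dim W))),
    [/\ intertwines (@tw_rep_act U) (@tw_rep_act V) f,
        intertwines (@tw_rep_act V) (@tw_rep_act W) g & short_exact f g].

Definition tw_Rep : zmodType := K0 tw_rep_ses.

End TwistedRepresentations.

Lemma dd_coef_aux (F : fieldType) (p q r s t a b c d e f i j l m n : F) :
  e != 0 -> d != 0 -> c != 0 -> i != 0 ->
  p != 0 -> s != 0 -> b != 0 -> j != 0 ->
  p * q * r = s * t -> a * b * c = s * d ->
  e * b * f = i * j -> l * m * p = n * j ->
  m * t / d * (l * a / e) = f * r / c * (n * q / i).
Proof.
move=> e0 d0 c0 i0 p0 s0 b0 j0 E1 E2 E3 E4.
rewrite !mulf_div; apply/eqP; rewrite eqr_div ?mulf_neq0 //; apply/eqP.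
have K0 : p * s * b * j != 0 by rewrite !mulf_neq0.
apply: (mulIf K0).
rewrite [LHS](AC ((2*2)*2*4) ((3*1*7)*(8*2)*(4*9*5)*(6*10))) /=.
rewrite E4 -E1 E2 -E3.
by rewrite [RHS](AC ((2*2)*2*4) ((3*10)*(7*4*2)*(8*5)*(6*9*1))).
Qed.

(* The function [a] stands for \sum_(g, x) a (g, x) <g, x>.  The cocycle is a
   phantom argument: the product depends on it. *)
Definition drinfeld_double (R : realType) (G : finGroupType)
  (w : cocycle3 R G) := {ffun G * G -> R[i]}.

Section Double.
Variables (R : realType) (G : finGroupType) (w : cocycle3 R G).

Implicit Types (g h k x y : G) (p q r : G * G).

Definition dd_coef h g x : R[i] :=
  w h g x * w (h * g * x * (h * g)^-1)%g h g / w h (g * x * g^-1)%g g.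

Lemma cocycle3_neq0 h g x : w h g x != 0.
Proof. by rewrite -normr_eq0 cocycle3_norm oner_eq0. Qed.

Lemma cocycle3E k h g x :
  w h g x * w k (h * g)%g x * w k h g = w (k * h)%g g x * w k h (g * x)%g.
Proof.
have := cocycle3_closed w k h g x.
set a := w h g x; set b := w (k * h)%g g x; set c := w k (h * g)%g x.
set d := w k h (g * x)%g; set e := w k h g => E.
apply: divr1_eq; rewrite -E invfM.
by rewrite [LHS](AC (3*2) (1*4*2*5*3)).
Qed.

Lemma dd_coef_cocycle k h g x :
  dd_coef k (h * g)%g x * dd_coef h g x =
  dd_coef k h (g * x * g^-1)%g * dd_coef (k * h)%g g x.
Proof.
rewrite /dd_coef.
set y := (g * x * g^-1)%g.
have -> : (h * g * x * (h * g)^-1 = h * y * h^-1)%g by rewrite /y invMg !mulgA.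
have -> : (k * h * y * (k * h)^-1 = k * (h * y * h^-1) * k^-1)%g.
  by rewrite invMg !mulgA.
have -> : (k * (h * g) * x * (k * (h * g))^-1 =
           k * (h * y * h^-1) * k^-1)%g by rewrite /y !invMg !mulgA.
have -> : (k * h * g * x * (k * h * g)^-1 =
           k * (h * y * h^-1) * k^-1)%g by rewrite /y !invMg !mulgA.
set z := (h * y * h^-1)%g; set v := (k * z * k^-1)%g.
have E1 := cocycle3E v k h g; have E2 := cocycle3E k z h g.
have E3 := cocycle3E k h y g; have E4 := cocycle3E k h g x.
have vk : (v * k = k * z)%g by rewrite /v mulgKV.
have zh : (z * h = h * y)%g by rewrite /z mulgKV.
have yg : (y * g = g * x)%g by rewrite /y mulgKV.
rewrite {}vk in E1; rewrite {}zh in E2; rewrite {}yg in E3.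
by apply: dd_coef_aux E1 E2 E3 E4; exact: cocycle3_neq0.
Qed.

Local Notation D := (drinfeld_double w).

HB.instance Definition _ := GRing.Lmodule.on D.

Implicit Types a b c : D.

Definition dd_basis g x : D := [ffun p => (p == (g, x))%:R].

Definition dd_basis_mul h y g x : D :=
  if y == (g * x * g^-1)%g then dd_coef h g x *: dd_basis (h * g)%g x else 0.

Definition dd_mul a b : D :=
  \sum_p \sum_q (a p * b q) *: dd_basis_mul p.1 p.2 q.1 q.2.

Definition dd_one : D := \sum_x dd_basis 1%g x.

Lemma dd_mul_is_linear a : linear (dd_mul a).
Proof.
move=> k b c; rewrite /dd_mul scaler_sumr -big_split; apply: eq_bigr => p _ /=.
rewrite scaler_sumr -big_split; apply: eq_bigr => q _ /=.
by rewrite !ffunE scalerA -scalerDl mulrDr mulrCA.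
Qed.

Definition dd_mulr b a := dd_mul a b.

Lemma dd_mulr_is_linear b : linear (dd_mulr b).
Proof.
move=> k a c; rewrite /dd_mulr /dd_mul scaler_sumr -big_split.
apply: eq_bigr => p _ /=.
rewrite scaler_sumr -big_split; apply: eq_bigr => q _ /=.
by rewrite !ffunE scalerA -scalerDl mulrDl mulrA.
Qed.

HB.instance Definition _ a :=
  GRing.isLinear.Build R[i] D D *:%R (dd_mul a)
    (dd_mul_is_linear a).

HB.instance Definition _ b :=
  GRing.isLinear.Build R[i] D D *:%R (dd_mulr b)
    (dd_mulr_is_linear b).

Lemma dd_mul_basis h y g x :
  dd_mul (dd_basis h y) (dd_basis g x) = dd_basis_mul h y g x.
Proof.
rewrite /dd_mul (bigD1 (h, y)) //= [X in _ + X]big1 ?addr0; last first.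
  by move=> p /negPf np; rewrite big1 // => q _; rewrite ffunE np mul0r scale0r.
rewrite (bigD1 (g, x)) //= [X in _ + X]big1 ?addr0; last first.
  by move=> q /negPf nq; rewrite [dd_basis g x q]ffunE nq mulr0 scale0r.
by rewrite !ffunE !eqxx mulr1 scale1r.
Qed.

Lemma dd_basisE a : a = \sum_p a p *: dd_basis p.1 p.2.
Proof.
apply/ffunP => q; rewrite sum_ffunE (bigD1 q) //= big1 ?addr0 => [|p np].
  by rewrite !ffunE -surjective_pairing eqxx /GRing.scale /= mulr1.
by rewrite !ffunE -surjective_pairing eq_sym (negPf np) /GRing.scale /= mulr0.
Qed.

Lemma dd_lin_ext (f1 f2 : {linear D -> D}) :
  (forall g x, f1 (dd_basis g x) = f2 (dd_basis g x)) -> f1 =1 f2.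
Proof.
move=> E a; rewrite [a]dd_basisE !linear_sum; apply: eq_bigr => p _.
by rewrite !linearZ /= E.
Qed.

Lemma dd_mulA_basis k z h y g x :
  dd_mul (dd_basis k z) (dd_mul (dd_basis h y) (dd_basis g x)) =
  dd_mul (dd_mul (dd_basis k z) (dd_basis h y)) (dd_basis g x).
Proof.
rewrite !dd_mul_basis -[RHS]/(dd_mulr _ _) /dd_basis_mul.
have [->|ny] := eqVneq y (g * x * g^-1)%g; last first.
  rewrite linear0; case: eqP => _; last by rewrite linear0.
  by rewrite linearZ /= /dd_mulr dd_mul_basis /dd_basis_mul (negPf ny) scaler0.
rewrite linearZ /= dd_mul_basis /dd_basis_mul.
have -> : (h * g * x * (h * g)^-1 = h * (g * x * g^-1) * h^-1)%g.
  by rewrite invMg !mulgA.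
case: eqP => _; last by rewrite scaler0 linear0.
rewrite [RHS]linearZ /= /dd_mulr dd_mul_basis /dd_basis_mul eqxx.
by rewrite !scalerA [in LHS]mulrC dd_coef_cocycle mulgA.
Qed.

Lemma dd_mulA : associative dd_mul.
Proof.
move=> a b c.
apply: (dd_lin_ext (f1 := dd_mul a \o dd_mul b) (f2 := dd_mul (dd_mul a b))).
move=> {c} g x /=; move: b.
apply: (dd_lin_ext (f1 := dd_mul a \o dd_mulr (dd_basis g x))
                   (f2 := dd_mulr (dd_basis g x) \o dd_mul a)).
move=> h y /=; move: a.
apply: (dd_lin_ext (f1 := dd_mulr (dd_mul (dd_basis h y) (dd_basis g x)))
                   (f2 := dd_mulr (dd_basis g x) \o dd_mulr (dd_basis h y))).
by move=> k z; exact: dd_mulA_basis.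
Qed.

Lemma dd_mul1 : left_id dd_one dd_mul.
Proof.
apply: (dd_lin_ext (f1 := dd_mul dd_one) (f2 := idfun)) => g x /=.
rewrite -/(dd_mulr _ _) /dd_one linear_sum (bigD1 (g * x * g^-1)%g) //=.
rewrite /dd_mulr dd_mul_basis /dd_basis_mul eqxx big1 => [|y ny].
  rewrite addr0 /dd_coef mul1g !(cocycle3_1l, cocycle3_1m).
  by rewrite invr1 !mulr1 scale1r.
by rewrite dd_mul_basis /dd_basis_mul (negPf ny).
Qed.

Lemma dd_mulr1 : right_id dd_one dd_mul.
Proof.
apply: (dd_lin_ext (f1 := dd_mulr dd_one) (f2 := idfun)) => g x /=.
rewrite /dd_mulr /dd_one linear_sum (bigD1 x) //=.
rewrite dd_mul_basis /dd_basis_mul !mul1g invg1 mulg1 eqxx big1 => [|y ny].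
  rewrite addr0 /dd_coef !mulg1 mul1g invg1 mulg1 !(cocycle3_1m, cocycle3_1r).
  by rewrite invr1 !mulr1 scale1r.
by rewrite dd_mul_basis /dd_basis_mul mul1g invg1 mulg1 eq_sym (negPf ny).
Qed.

Lemma dd_mulDl : left_distributive dd_mul +%R.
Proof. by move=> a b c; rewrite -![dd_mul _ c]/(dd_mulr c _) linearD. Qed.

Lemma dd_mulDr : right_distributive dd_mul +%R.
Proof. by move=> a b c; rewrite linearD. Qed.

Lemma dd_one_neq0 : dd_one != 0.
Proof.
apply/eqP => /ffunP/(_ (1%g, 1%g)); rewrite sum_ffunE (bigD1 1%g) //= big1.
  by rewrite !ffunE eqxx addr0 => /eqP; rewrite oner_eq0.
by move=> x nx; rewrite ffunE xpair_eqE [1%g == x]eq_sym (negPf nx) andbF.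
Qed.

HB.instance Definition _ := GRing.Zmodule_isNzRing.Build D
  dd_mulA dd_mul1 dd_mulr1 dd_mulDl dd_mulDr dd_one_neq0.

Lemma dd_scalerAl (k : R[i]) a b : k *: (a * b) = (k *: a) * b.
Proof. by rewrite -![_ * b]/(dd_mulr b _) linearZ. Qed.

Lemma dd_scalerAr (k : R[i]) a b : k *: (a * b) = a * (k *: b).
Proof. by rewrite -![a * _]/(dd_mul a _) linearZ. Qed.

HB.instance Definition _ :=
  GRing.Lmodule_isLalgebra.Build R[i] D dd_scalerAl.
HB.instance Definition _ :=
  GRing.Lalgebra_isAlgebra.Build R[i] D dd_scalerAr.

End Double.

Section Transgression.
Variables (R : realType) (G : finGroupType) (w : cocycle3 R G) (x : G).

Local Notation Cx := [subg 'C[x]].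

Definition transgression_fun (h g : Cx) : R[i] :=
  w (sgval h) (sgval g) x * w x (sgval h) (sgval g)
    / w (sgval h) x (sgval g).

Lemma sub_cent1_conj (g : Cx) : (sgval g * x * (sgval g)^-1 = x)%g.
Proof. by have /cent1P -> := valP g; rewrite mulgK. Qed.

Lemma transgression_coef (h g : Cx) :
  transgression_fun h g = dd_coef w (sgval h) (sgval g) x.
Proof.
rewrite /dd_coef sub_cent1_conj.
have -> : (sgval h * sgval g * x * (sgval h * sgval g)^-1)%g = x.
  exact: (sub_cent1_conj (h * g)%g).
by [].
Qed.

Lemma transgression_norm h g : `|transgression_fun h g| = 1.
Proof.
by rewrite /transgression_fun !normrM normrV ?unitfE ?cocycle3_neq0 //
  !cocycle3_norm invr1 !mulr1.
Qed.

Lemma transgression_1l g : transgression_fun 1%g g = 1.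
Proof.
by rewrite /transgression_fun !(cocycle3_1l, cocycle3_1m) invr1 !mulr1.
Qed.

Lemma transgression_1r h : transgression_fun h 1%g = 1.
Proof.
by rewrite /transgression_fun !(cocycle3_1r, cocycle3_1m) invr1 !mulr1.
Qed.

Lemma transgression_closed k h g :
  transgression_fun h g * (transgression_fun (k * h)%g g)^-1
    * transgression_fun k (h * g)%g * (transgression_fun k h)^-1 = 1.
Proof.
have nz k' h' : transgression_fun k' h' != 0.
  by rewrite -normr_eq0 transgression_norm oner_eq0.
have E : transgression_fun k (h * g)%g * transgression_fun h g =
         transgression_fun k h * transgression_fun (k * h)%g g.
  by rewrite !transgression_coef dd_coef_cocycle sub_cent1_conj.
rewrite [LHS](AC 4 ((3*1)*(4*2))) /= -invfM E.
by apply: divff; rewrite mulf_neq0.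
Qed.

Definition transgression : cocycle2 R Cx :=
  Cocycle2 transgression_norm transgression_1l transgression_1r
    transgression_closed.

End Transgression.

(* Main.v *)
(* Writing e_x = <1, x>, a representation M of the double splits as the sum of
   the spaces e_x M, and <h, x> with h in C_x makes e_x M a tau(w)|_x-twisted
   representation of C_x.  Conversely a twisted representation V of C_x
   coinduces to Hom_{C_x}(e_x D, V), realized as the functions phi : G -> V with
   beta(c, g, x^g) phi(c g) = c . phi(g), where beta is the structure constant
   of the double and x^g = g^-1 x g.  Both constructions are exact (coinduction
   by averaging over C_x), restricting the coinduction of V returns V, and the
   coinduction of e_x M is the part of M supported on the class of x, so they
   induce mutually inverse maps of Grothendieck groups. *)
Require Import Defs.
From HB Require Import structures.
From mathcomp Require Import all_boot all_order all_algebra all_fingroup.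
From mathcomp Require Import boolp reals complex freeg.

Set Implicit Arguments.
Unset Strict Implicit.
Unset Printing Implicit Defensive.

Import GRing.Theory Num.Theory.

Local Open Scope ring_scope.

(** * Universal property of the Grothendieck group *)

Section K0Theory.
Variables (Ob : Type) (ses : Ob -> Ob -> Ob -> Prop).

Local Notation K := (K0 ses).
Local Notation proj := (\pi_K : K0_free Ob -> K)%qT.

Definition K0_class (a : Ob) : K := proj << (a : {classic Ob}) >>.

Lemma K0_class_ses a b c :
  ses a b c -> K0_class b = K0_class a + K0_class c.
Proof.
move=> H; apply/eqP; rewrite -subr_eq0 opprD addrA -!raddfB /=.
rewrite -(raddf0 proj) -Quotient.idealrBE subr0.
by apply/asboolP; apply: K0_rel_ses.
Qed.

(** A representative in the free group is an integer combination of generators, and both maps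
    commute with such combinations. *)
Lemma K0_ext (A : zmodType) (f g : {additive K -> A}) :
  (forall a, f (K0_class a) = g (K0_class a)) -> f =1 g.
Proof.
move=> E u; rewrite -[u]generic_quotient.reprK.
rewrite -(freeg_sumE (generic_quotient.repr u)) !raddf_sum.
apply: eq_bigr => a _ /=.
set n := coeff a _.
have -> : <<n *g a>> = << a >> *~ n :> K0_free Ob.
  by rewrite freeg_mulz intz.
by rewrite !raddfMz; congr (_ *~ _); apply: E.
Qed.

(** The extension of [phi] to the free group kills [K0_rel], by induction on how the relations are
    generated, so its value does not depend on the chosen representative. *)
Lemma K0_lift (A : zmodType) (phi : Ob -> A) :
  (forall a b c, ses a b c -> phi b = phi a + phi c) ->
  exists f : {additive K -> A}, forall a, f (K0_class a) = phi a.
Proof.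
move=> E; pose L0 : K0_free Ob -> A := fglift (phi : {classic Ob} -> zmodule A).
have LB : zmod_morphism L0.
  exact: (@lift_is_additive int {classic Ob} (zmodule A) phi).
pose La := GRing.isZmodMorphism.Build _ _ L0 LB.
pose L : {additive K0_free Ob -> A} := HB.pack L0 La.
have LU a : L << a >> = phi a by rewrite /L /= /L0 liftU scale1r.
have LK u : K0_rel ses u -> L u = 0.
  elim=> [a b c /E H||v v' _ Hv _ Hv'].
  - rewrite !raddfB !LU H.
    by rewrite addrAC addrK subrr.
  - by rewrite raddf0.
  - by rewrite raddfB Hv Hv' subrr.
have Lpi u : L (generic_quotient.repr (proj u)) = L u.
  apply/eqP; rewrite -subr_eq0 -[_ - _](raddfB L); apply/eqP/LK.
  apply/asboolP; rewrite -[asbool _]/(_ \in K0_relb ses) Quotient.idealrBE.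
  by rewrite generic_quotient.reprK.
pose f (u : K) : A := L (generic_quotient.repr u).
have fB : zmod_morphism f.
  move=> u v; rewrite /f -{1}[u]generic_quotient.reprK.
  rewrite -{1}[v]generic_quotient.reprK -raddfB Lpi.
  by rewrite [LHS]raddfB.
pose fa := GRing.isZmodMorphism.Build _ _ f fB.
by exists (HB.pack f fa : {additive K -> A}) => a; rewrite /= /f Lpi LU.
Qed.

End K0Theory.

(** * Classes of invariant subspaces *)

(** Coordinates in a basis of [U] give [j], and [p] is a left inverse of it defined on all of [V].
    This replaces a subspace by some F^n, the only spaces that carry representations here. *)
Lemma subspace_model (F : fieldType) (V : vectType F) (U : {vspace V}) :
  exists n (j : 'Hom('cV[F]_n, V)) (p : 'Hom(V, 'cV[F]_n)),
    [/\ limg j = U, cancel j p & {in U, cancel p j}].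
Proof.
pose f (v : 'cV[F]_(\dim U)) := \sum_i v i 0 *: (vbasis U)`_i.
have fl : linear f.
  move=> k u v; rewrite /f scaler_sumr -big_split; apply: eq_bigr => i _.
  by rewrite !mxE scalerDl scalerA.
pose fa := GRing.isLinear.Build _ _ _ _ f fl.
pose j := linfun (HB.pack f fa : {linear _ -> _}).
have jE v : j v = f v by rewrite lfunE.
have kj : lker j == 0%VS.
  apply/lker0P => u v; rewrite !jE => E; apply/colP => i.
  have fU : free (vbasis U) by apply: basis_free (vbasisP U).
  rewrite -(coord_sum_free (fun i => u i 0) i fU).
  by rewrite -(coord_sum_free (fun i => v i 0) i fU) -/(f u) E.
have ij : limg j = U.
  apply/vspaceP => v; apply/memv_imgP/idP => [[u _ ->]|vU].
    rewrite jE; apply: memv_suml => i _; apply: memvZ; apply: vbasis_mem.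
    by apply: mem_nth; rewrite size_tuple.
  exists (\col_i coord (vbasis U) i v); first exact: memvf.
  by rewrite jE {1}(coord_vbasis vU); apply: eq_bigr => i _; rewrite mxE.
exists (\dim U), j, j^-1%VF; split=> //; first exact: lker0_lfunK.
by rewrite -{1}ij; apply: limg_lfunVK.
Qed.

Section RealizedSubspaces.
Variables (F : fieldType) (S Ob : Type) (dim : Ob -> nat).
Variable act : forall a, S -> 'End('cV[F]_(dim a)).
Variable ses : Ob -> Ob -> Ob -> Prop.
(** Keeping [ses] abstract lets the same lemmas serve representations of the double and twisted
    representations. *)
Hypothesis ses_intro : forall a b c
  (f : 'Hom('cV[F]_(dim a), 'cV[F]_(dim b)))
  (g : 'Hom('cV[F]_(dim b), 'cV[F]_(dim c))),
  intertwines (act a) (act b) f -> intertwines (act b) (act c) g ->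
  short_exact f g -> ses a b c.

(* Objects live on the spaces F^n; this relation lets an arbitrary subspace [U]
   stable under the operators [r s] stand for such an object. *)
Definition realizes a (V : vectType F) (U : {vspace V}) (r : S -> 'End(V)) :=
  exists (j : 'Hom('cV[F]_(dim a), V)) (p : 'Hom(V, 'cV[F]_(dim a))),
    [/\ limg j = U, cancel j p, {in U, cancel p j}
      & forall s v, j (act a s v) = r s (j v)].

Hypothesis zero_realizable : forall (V : vectType F) (r : S -> 'End(V)),
  exists a, realizes a 0%VS r.

Lemma realizes_self a : realizes a fullv (act a).
Proof.
by exists \1%VF, \1%VF; split=> [|v|v _|s v];
  rewrite ?id_lfunE // (fixedSpace_limg _) // fixedSpace_id.
Qed.

(** The assumptions on [f] and [g] describe an exact sequence 0 -> U1 -> U2 -> U3 -> 0; composing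
    with the embeddings and their left inverses carries it over to the column spaces. *)
Lemma realizes_ses a b c (V1 V2 V3 : vectType F) U1 U2 U3
    (r1 : S -> 'End(V1)) (r2 : S -> 'End(V2)) (r3 : S -> 'End(V3))
    (f : 'Hom(V1, V2)) (g : 'Hom(V2, V3)) :
  realizes a U1 r1 -> realizes b U2 r2 -> realizes c U3 r3 ->
  (forall s, {in U1, forall v, f (r1 s v) = r2 s (f v)}) ->
  (forall s, {in U2, forall v, g (r2 s v) = r3 s (g v)}) ->
  {in U1, forall v, f v = 0 -> v = 0} ->
  {in U1, forall v, f v \in U2} ->
  {in U1, forall v, g (f v) = 0} ->
  {in U2, forall v, g v = 0 -> exists2 u, u \in U1 & v = f u} ->
  (g @: U2 = U3)%VS -> ses a b c.
Proof.
move=> [j1 [p1 [i1 jp1 pj1 e1]]] [j2 [p2 [i2 jp2 pj2 e2]]].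
move=> [j3 [p3 [i3 jp3 pj3 e3]]] ef eg f0 fU gf0 gf gU.
have jU1 v : j1 v \in U1 by rewrite -i1 memv_img ?memvf.
have jU2 v : j2 v \in U2 by rewrite -i2 memv_img ?memvf.
have jU3 v : j3 v \in U3 by rewrite -i3 memv_img ?memvf.
have gU' v : v \in U2 -> g v \in U3 by move=> vU; rewrite -gU memv_img.
have E1 v : j2 (p2 (f (j1 v))) = f (j1 v) by rewrite pj2 ?fU.
have E2 v : j3 (p3 (g (j2 v))) = g (j2 v) by rewrite pj3 ?gU'.
apply: (@ses_intro a b c (p2 \o f \o j1)%VF (p3 \o g \o j2)%VF).
- move=> s; apply/lfunP => v; rewrite !comp_lfunE; apply: (can_inj jp2).
  by rewrite e2 E1 E1 e1 ef.
- move=> s; apply/lfunP => v; rewrite !comp_lfunE; apply: (can_inj jp3).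
  by rewrite e3 E2 E2 e2 eg.
- split.
  + apply/eqP/lker0P => u v; rewrite !comp_lfunE => /(congr1 j2).
    rewrite !E1 => /eqP; rewrite -subr_eq0 -!raddfB => /eqP E.
    apply/eqP; rewrite -subr_eq0; apply/eqP/(can_inj jp1).
    by rewrite raddf0; apply: f0 => //; rewrite raddfB.
  + apply/vspaceP => v; rewrite memv_ker !comp_lfunE; apply/memv_imgP/eqP.
      by move=> [u _ ->]; rewrite !comp_lfunE E1 gf0 ?raddf0.
    move=> /(congr1 j3); rewrite E2 raddf0 => /gf => /(_ (jU2 v)) [u uU E].
    exists (p1 u); rewrite ?memvf // !comp_lfunE; apply: (can_inj jp2).
    by rewrite E1 pj1.
  + apply/vspaceP => v; rewrite memvf; apply/memv_imgP.
    have : j3 v \in U3 by [].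
    rewrite -gU => /memv_imgP [u uU E]; exists (p2 u); rewrite ?memvf //.
    by rewrite !comp_lfunE pj2 // -E jp3.
Qed.

Local Notation cls := (K0_class ses).

(** A relation rather than a function: the realizing object is not canonical, and [has_class_iso]
    shows that its class does not depend on the choice. *)
Definition has_class (V : vectType F) (U : {vspace V}) (r : S -> 'End(V))
    (u : K0 ses) :=
  exists2 a, realizes a U r & u = cls a.

Lemma has_class_self a : has_class fullv (act a) (cls a).
Proof. by exists a => //; apply: realizes_self. Qed.

Lemma has_class_ses (V1 V2 V3 : vectType F) U1 U2 U3
    (r1 : S -> 'End(V1)) (r2 : S -> 'End(V2)) (r3 : S -> 'End(V3))
    (f : 'Hom(V1, V2)) (g : 'Hom(V2, V3)) u1 u2 u3 :
  has_class U1 r1 u1 -> has_class U2 r2 u2 -> has_class U3 r3 u3 ->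
  (forall s, {in U1, forall v, f (r1 s v) = r2 s (f v)}) ->
  (forall s, {in U2, forall v, g (r2 s v) = r3 s (g v)}) ->
  {in U1, forall v, f v = 0 -> v = 0} ->
  {in U1, forall v, f v \in U2} ->
  {in U1, forall v, g (f v) = 0} ->
  {in U2, forall v, g v = 0 -> exists2 u, u \in U1 & v = f u} ->
  (g @: U2 = U3)%VS -> u2 = u1 + u3.
Proof.
move=> [a ra ->] [b rb ->] [c rc ->] *; apply: K0_class_ses.
by apply: realizes_ses ra rb rc _ _ _ _ _ _ _; eassumption.
Qed.

Lemma has_class0_ex (V : vectType F) (r : S -> 'End(V)) :
  exists u, has_class (0%VS : {vspace V}) r u.
Proof.
by have [z ?] := zero_realizable r; exists (cls z), z.
Qed.

(** The sequence of zero spaces is exact, so u = u + u. *)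
Lemma has_class0 (V : vectType F) (r : S -> 'End(V)) u :
  has_class (0%VS : {vspace V}) r u -> u = 0.
Proof.
move=> H; apply: (addrI u); rewrite addr0; symmetry.
apply: (has_class_ses (f := \1%VF) (g := \1%VF) H H H) => //.
- by move=> s v _; rewrite !id_lfunE.
- by move=> s v _; rewrite !id_lfunE.
- by move=> v _; rewrite id_lfunE.
- by move=> v; rewrite id_lfunE.
- by move=> v; rewrite memv0 => /eqP ->; rewrite !raddf0.
- by move=> v vU _; exists v; rewrite ?id_lfunE.
- exact: limg0.
Qed.

(** An isomorphism is a short exact sequence whose third term is zero. *)
Lemma has_class_iso (V1 V2 : vectType F) U1 U2
    (r1 : S -> 'End(V1)) (r2 : S -> 'End(V2)) (f : 'Hom(V1, V2)) u1 u2 :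
  has_class U1 r1 u1 -> has_class U2 r2 u2 ->
  (forall s, {in U1, forall v, f (r1 s v) = r2 s (f v)}) ->
  {in U1, forall v, f v = 0 -> v = 0} ->
  (f @: U1 = U2)%VS -> u1 = u2.
Proof.
move=> H1 H2 ef f0 fU; have [u0 H0] := has_class0_ex r1.
have fU' v : v \in U1 -> f v \in U2 by move=> vU; rewrite -fU memv_img.
have u00 := has_class0 H0; rewrite u00 in H0.
rewrite -[LHS]addr0; symmetry.
apply: (has_class_ses (f := f) (g := 0) H1 H2 H0) => //.
- by move=> s v _; rewrite !zero_lfunE raddf0.
- by move=> v _; rewrite zero_lfunE.
- by move=> v; rewrite -fU => /memv_imgP [w wU ->] _; exists w.
- by apply/eqP; rewrite -subv0; apply/subvP => _ /memv_imgP [w _ ->];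
    rewrite zero_lfunE mem0v.
Qed.

(** Induction on [t]: with [E] the sum of the remaining projections, the inclusion of the image of
    [e i] and the map [E] form a short exact sequence. The assumption on partial sums supplies a
    class for the image of [E]. *)
Lemma has_class_sum (V : vectType F) (r : S -> 'End(V)) (I : eqType)
    (t : seq I) (e : I -> 'End(V)) (u : I -> K0 ses) v :
  uniq t -> (forall i s w, e i (r s w) = r s (e i w)) ->
  (forall i w, e i (e i w) = e i w) ->
  (forall i k w, i != k -> e i (e k w) = 0) ->
  (forall i, i \in t -> has_class (limg (e i)) r (u i)) ->
  (forall t', exists u', has_class (limg (\sum_(i <- t') e i)) r u') ->
  has_class (limg (\sum_(i <- t) e i)) r v -> v = \sum_(i <- t) u i.
Proof.
move=> ut er ei eo + ex; elim: t ut v => [_ v _|i t IH /= /andP [it ut] v Hu].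
  rewrite !big_nil => H; apply: (@has_class0 V r).
  suff <- : limg (0 : 'End(V)) = 0%VS by [].
  by apply/eqP; rewrite -subv0; apply/subvP => _ /memv_imgP [w _ ->];
    rewrite zero_lfunE mem0v.
rewrite !big_cons => Hv; have [v' Hv'] := ex t.
have Hi : has_class (limg (e i)) r (u i) by apply: Hu; rewrite inE eqxx.
rewrite -(IH ut v' _ Hv'); last by move=> k kt; apply: Hu; rewrite inE kt orbT.
set E := \sum_(k <- t) e k in Hv Hv' *.
have eE w : e i (E w) = 0.
  rewrite /E sum_lfunE raddf_sum big_seq big1 // => k kt; apply: eo.
  by apply: contraNneq it => ->.
have Ee w : E (e i w) = 0.
  rewrite /E sum_lfunE big_seq big1 // => k kt; apply: eo.
  by apply: contraNneq it => <-.
have EE w : E (E w) = E w.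
  have -> : E w = \sum_(k <- t) e k w by rewrite /E sum_lfunE.
  rewrite raddf_sum !big_seq; apply: eq_bigr => k kt.
  rewrite /= /E sum_lfunE (bigD1_seq k) //= ei big1 ?addr0 // => l lk.
  exact: eo.
have rE s w : E (r s w) = r s (E w).
  by rewrite /E !sum_lfunE raddf_sum; apply: eq_bigr => k _; apply: er.
apply: (has_class_ses (f := \1%VF) (g := E) Hi Hv Hv').
- by move=> s w _; rewrite !id_lfunE.
- by move=> s w _.
- by move=> w _; rewrite id_lfunE.
- move=> _ /memv_imgP [w _ ->]; rewrite id_lfunE; apply/memv_imgP.
  by exists (e i w); rewrite ?memvf // add_lfunE ei Ee addr0.
- by move=> _ /memv_imgP [w _ ->]; rewrite id_lfunE Ee.
- move=> _ /memv_imgP [w _ ->]; rewrite add_lfunE raddfD /= Ee add0r EE => ->.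
  by rewrite addr0; exists (e i w); rewrite ?id_lfunE // memv_img ?memvf.
- apply/vspaceP => w; apply/memv_imgP/memv_imgP => [[w' _ ->]|[w' _ ->]].
    by exists w'; rewrite ?memvf.
  exists (E w'); last by rewrite EE.
  apply/memv_imgP; exists (E w'); rewrite ?memvf //.
  by rewrite add_lfunE eE add0r EE.
Qed.

End RealizedSubspaces.

(** * Representations of the double in terms of its basis *)

Section DoubleCoefficients.
Variables (R : realType) (G : finGroupType) (w : cocycle3 R G).
Implicit Types (g h k x y : G).

Lemma conjVgE x g : (x ^ g^-1 = g * x * g^-1)%g.
Proof. by rewrite conjgE invgK mulgA. Qed.

Lemma conj_eqV y z h : ((y ^ h^-1)%g == z) = (y == (z ^ h)%g).
Proof. by apply/eqP/eqP => [<-|->]; rewrite (conjgK, conjgKV). Qed.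

(** This is associativity of the double on structure constants, with conjugation written as the
    right action [x ^ g]. *)
Lemma dd_coefA k h g x :
  dd_coef w k (h * g)%g x * dd_coef w h g x =
  dd_coef w k h (x ^ g^-1)%g * dd_coef w (k * h)%g g x.
Proof. by rewrite conjVgE dd_coef_cocycle. Qed.

Lemma dd_coef1g g x : dd_coef w 1%g g x = 1.
Proof. by rewrite /dd_coef !(cocycle3_1l, cocycle3_1m) invr1 !mulr1. Qed.

Lemma dd_coefg1 h x : dd_coef w h 1%g x = 1.
Proof. by rewrite /dd_coef !(cocycle3_1r, cocycle3_1m) invr1 !mulr1. Qed.

Lemma dd_coef_neq0 h g x : dd_coef w h g x != 0.
Proof. by rewrite /dd_coef !mulf_neq0 ?invr_eq0 ?cocycle3_neq0. Qed.

End DoubleCoefficients.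

Section DoubleRepresentations.
Variables (R : realType) (G : finGroupType) (w : cocycle3 R G).
Local Notation D := (drinfeld_double w).
Local Notation beta := (dd_coef w).

(** The basis elements determine the whole action by linearity, so [G * G] can serve as the set of
    operators in the abstract results on stable subspaces. *)
Definition dd_act (a : alg_rep D) (s : G * G) :=
  alg_rep_act a (dd_basis w s.1 s.2).

Lemma alg_rep_act_sum (a : alg_rep D) I (t : seq I) (P : pred I)
    (k : I -> R[i]) (d : I -> D) v :
  alg_rep_act a (\sum_(i <- t | P i) k i *: d i) v =
  \sum_(i <- t | P i) k i *: alg_rep_act a (d i) v.
Proof.
pose fa := GRing.isLinear.Build _ _ _ _ _ (alg_rep_linear a).
pose f : {linear D -> _} := HB.pack (@alg_rep_act _ _ a) fa.
rewrite -[alg_rep_act a _]/(f _) linear_sum sum_lfunE; apply: eq_bigr => i _.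
by rewrite linearZ scale_lfunE.
Qed.

Lemma dd_actE a (d : D) v : alg_rep_act a d v = \sum_p d p *: dd_act a p v.
Proof. by rewrite {1}[d]dd_basisE alg_rep_act_sum. Qed.

Lemma dd_act0 a v : alg_rep_act a (0 : D) v = 0.
Proof. by rewrite dd_actE big1 // => p _; rewrite ffunE scale0r. Qed.

Lemma dd_actM a h y g x v :
  dd_act a (h, y) (dd_act a (g, x) v) =
  if y == (x ^ g^-1)%g then beta h g x *: dd_act a ((h * g)%g, x) v else 0.
Proof.
rewrite /dd_act -comp_lfunE -alg_repM -[_ * _]/(dd_mul _ _) dd_mul_basis.
rewrite /dd_basis_mul -conjVgE; case: eqP => _; last exact: dd_act0.
(* A scalar multiple is handled as a sum with one term. *)
have := alg_rep_act_sum [:: tt] xpredT (fun=> beta h g x)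
  (fun=> dd_basis w (h * g) x) v.
by rewrite !big_seq1.
Qed.

Lemma dd_act1 a v : \sum_x dd_act a (1%g, x) v = v.
Proof.
rewrite -[RHS]id_lfunE -alg_rep1 -[1]/(dd_one w) /dd_one.
rewrite (eq_bigr (fun x => 1 *: dd_basis w 1 x)); last first.
  by move=> x _; rewrite scale1r.
by rewrite alg_rep_act_sum; apply: eq_bigr => x _; rewrite scale1r.
Qed.

Lemma dd_ses_intro (a b c : alg_rep D)
    (f : 'Hom('cV[R[i]]_(alg_rep_dim a), 'cV[R[i]]_(alg_rep_dim b)))
    (g : 'Hom('cV[R[i]]_(alg_rep_dim b), 'cV[R[i]]_(alg_rep_dim c))) :
  intertwines (dd_act a) (dd_act b) f -> intertwines (dd_act b) (dd_act c) g ->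
  short_exact f g -> alg_rep_ses a b c.
Proof.
have ext (a' b' : alg_rep D)
    (f' : 'Hom('cV[R[i]]_(alg_rep_dim a'), 'cV[R[i]]_(alg_rep_dim b'))) :
    intertwines (dd_act a') (dd_act b') f' ->
    intertwines (@alg_rep_act _ _ a') (@alg_rep_act _ _ b') f'.
  move=> H d; apply/lfunP => v; rewrite !comp_lfunE !dd_actE linear_sum.
  apply: eq_bigr => p _; rewrite linearZ /=; congr (_ *: _).
  by have /lfunP/(_ v) := H p; rewrite !comp_lfunE.
by move=> Hf Hg E; exists f, g; split=> //; apply: ext.
Qed.

(** A converse to [dd_actM] and [dd_act1]: operators obeying the relations of the basis extend
    linearly to a representation of the algebra, after transport to a column space. *)
Lemma dd_realizable (V : vectType R[i]) (U : {vspace V})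
    (r : G * G -> 'End(V)) :
  (forall s, {in U, forall v, r s v \in U}) ->
  (forall h y g x, {in U, forall v, r (h, y) (r (g, x) v) =
     if y == (x ^ g^-1)%g then beta h g x *: r ((h * g)%g, x) v else 0}) ->
  {in U, forall v, \sum_x r (1%g, x) v = v} ->
  exists a : alg_rep D, realizes dd_act a U r.
Proof.
move=> rU rM r1; have [n [j [p [ij jp pj]]]] := subspace_model U.
have jU v : j v \in U by rewrite -ij memv_img ?memvf.
pose act0 s := (p \o r s \o j)%VF.
have act0E s v : j (act0 s v) = r s (j v).
  by rewrite !comp_lfunE pj // rU.
pose act (d : D) := \sum_s d s *: act0 s.
have actE d v : act d v = \sum_s d s *: act0 s v.
  by rewrite /act sum_lfunE; apply: eq_bigr => s _; rewrite scale_lfunE.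
have actl : linear act.
  move=> k d d'; rewrite /act scaler_sumr -big_split; apply: eq_bigr => s _ /=.
  by rewrite !ffunE scalerDl scalerA.
have actB g x : act (dd_basis w g x) = act0 (g, x).
  rewrite /act (bigD1 (g, x)) //= ffunE eqxx scale1r big1 ?addr0 // => s ns.
  by rewrite ffunE (negPf ns) scale0r.
pose actla := GRing.isLinear.Build _ _ _ _ act actl.
pose actL : {linear D -> _} := HB.pack act actla.
have act1 : act 1 = \1%VF.
  apply/lfunP => v; rewrite -[1]/(dd_one w) -[act _]/(actL _) linear_sum.
  rewrite sum_lfunE id_lfunE; apply: (can_inj jp); rewrite linear_sum /=.
  rewrite -[RHS](r1 (j v)) //; apply: eq_bigr => x _.
  by rewrite actB act0E.
have actM (d d' : D) : act (d * d') = (act d \o act d')%VF.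
  rewrite -[d * d']/(dd_mul d d') /dd_mul -[act _]/(actL _) linear_sum.
  apply/lfunP => v; rewrite comp_lfunE sum_lfunE actE; apply: eq_bigr => s _.
  rewrite linear_sum sum_lfunE actE linear_sum scaler_sumr.
  apply: eq_bigr => s' _; rewrite !linearZ scale_lfunE /= scalerA.
  congr (_ *: _); first exact: mulrC.
  case: s s' => [h y] [g x] /=; apply: (can_inj jp).
  rewrite !act0E rM // /dd_basis_mul -conjVgE; case: eqP => _; last first.
    by rewrite -[act 0]/(actL 0) linear0 zero_lfunE linear0.
  by rewrite -[act (_ *: _)]/(actL _) linearZ scale_lfunE linearZ /= actB act0E.
exists (AlgRep actl act1 actM), j, p; split=> // -[g x] v.
by rewrite /dd_act /= actB act0E.
Qed.

Lemma dd_zero_realizable (V : vectType R[i]) (r : G * G -> 'End(V)) :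
  exists a : alg_rep D, realizes dd_act a 0%VS r.
Proof.
apply: dd_realizable => [s v|h y g x v|v]; rewrite memv0 => /eqP ->.
- by rewrite linear0 mem0v.
- by case: eqP => _; rewrite !linear0 ?scaler0.
- by rewrite big1 // => x _; rewrite linear0.
Qed.

Definition dd_class (V : vectType R[i]) (U : {vspace V}) (r : G * G -> 'End(V))
    (u : Rep D) := has_class dd_act U r u.

End DoubleRepresentations.

(** * Twisted representations on stable subspaces *)

Section TwistedRealizations.
Variables (R : realType) (H : finGroupType) (psi : cocycle2 R H).

Lemma tw_realizable (V : vectType R[i]) (U : {vspace V}) (r : H -> 'End(V)) :
  (forall h, {in U, forall v, r h v \in U}) ->
  {in U, forall v, r 1%g v = v} ->
  (forall h g, {in U, forall v, r h (r g v) = psi h g *: r (h * g)%g v}) ->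
  exists a : tw_rep psi, realizes (@tw_rep_act _ _ psi) a U r.
Proof.
move=> rU r1 rM; have [n [j [p [ij jp pj]]]] := subspace_model U.
have jU v : j v \in U by rewrite -ij memv_img ?memvf.
pose act s := (p \o r s \o j)%VF.
have actE s v : j (act s v) = r s (j v) by rewrite !comp_lfunE pj // rU.
have act1 : act 1%g = \1%VF.
  by apply/lfunP => v; apply: (can_inj jp); rewrite actE r1 // id_lfunE.
have actM h g : (act h \o act g)%VF = psi h g *: act (h * g)%g.
  apply/lfunP => v; apply: (can_inj jp).
  by rewrite comp_lfunE scale_lfunE linearZ /= !actE rM.
by exists (TwRep act1 actM), j, p.
Qed.

Lemma tw_ses_intro (a b c : tw_rep psi)
    (f : 'Hom('cV[R[i]]_(tw_rep_dim a), 'cV[R[i]]_(tw_rep_dim b)))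
    (g : 'Hom('cV[R[i]]_(tw_rep_dim b), 'cV[R[i]]_(tw_rep_dim c))) :
  intertwines (@tw_rep_act _ _ _ a) (@tw_rep_act _ _ _ b) f ->
  intertwines (@tw_rep_act _ _ _ b) (@tw_rep_act _ _ _ c) g ->
  short_exact f g -> tw_rep_ses a b c.
Proof. by exists f, g. Qed.

Lemma tw_zero_realizable (V : vectType R[i]) (r : H -> 'End(V)) :
  exists a : tw_rep psi, realizes (@tw_rep_act _ _ psi) a 0%VS r.
Proof.
apply: tw_realizable => [h v|v|h g v]; rewrite memv0 => /eqP ->.
- by rewrite linear0 mem0v.
- by rewrite linear0.
- by rewrite !linear0 ?scaler0.
Qed.

Definition tw_class (V : vectType R[i]) (U : {vspace V}) (r : H -> 'End(V))
    (u : tw_Rep psi) := has_class (@tw_rep_act _ _ psi) U r u.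

End TwistedRealizations.

(** * Restriction to a centralizer *)

(** Used to move a realization found inside a column space to the subspace for which that column
    space stands. *)
Lemma realizes_trans (F : fieldType) (S Ob : Type) (dim : Ob -> nat)
    (act : forall a, S -> 'End('cV[F]_(dim a))) a (V1 V2 : vectType F)
    (U : {vspace V1}) (r1 : S -> 'End(V1)) (r2 : S -> 'End(V2))
    (j : 'Hom(V1, V2)) (p : 'Hom(V2, V1)) :
  realizes act a U r1 -> cancel j p ->
  (forall s v, j (r1 s v) = r2 s (j v)) -> realizes act a (j @: U)%VS r2.
Proof.
move=> [j1 [p1 [i1 jp1 pj1 e1]]] jp e; exists (j \o j1)%VF, (p1 \o p)%VF.
split.
- by rewrite limg_comp i1.
- by move=> v; rewrite !comp_lfunE jp jp1.
- by move=> _ /memv_imgP [v vU ->]; rewrite !comp_lfunE jp pj1.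
- by move=> s v; rewrite !comp_lfunE e1 e.
Qed.

Section Restriction.
Variables (R : realType) (G : finGroupType) (w : cocycle3 R G) (x : G).
Local Notation D := (drinfeld_double w).
Local Notation beta := (dd_coef w).
Local Notation psi := (transgression w x).
Local Notation Cx := [subg 'C[x]].
Local Notation op a g y := (dd_act a (g%g, y%g)).

Lemma subcent_conj (h : Cx) : (x ^ sgval h)%g = x.
Proof. by rewrite -{1}(sub_cent1_conj h) -conjVgE conjgKV. Qed.

Lemma subcent_conjV (h : Cx) : (x ^ (sgval h)^-1)%g = x.
Proof. by rewrite conjVgE sub_cent1_conj. Qed.

Lemma transgressionE (h g : Cx) :
  psi h g = beta (sgval h) (sgval g) x.
Proof. exact: transgression_coef. Qed.

Lemma dd_idemE (a : alg_rep D) y v : v \in limg (op a 1 y) -> op a 1 y v = v.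
Proof.
by move=> /memv_imgP [u _ ->]; rewrite dd_actM invg1 conjg1 eqxx mulg1
  dd_coef1g scale1r.
Qed.

Lemma dd_idem_mem (a : alg_rep D) y g z v :
  (z ^ g^-1)%g = y -> op a g z v \in limg (op a 1 y).
Proof.
move=> <-; apply/memv_imgP; exists (op a g z v); rewrite ?memvf //.
by rewrite dd_actM eqxx dd_coef1g scale1r mul1g.
Qed.

Lemma restriction_class_ex (a : alg_rep D) : exists u : tw_Rep psi,
  tw_class (limg (op a 1 x)) (fun h => op a (sgval h) x) u.
Proof.
have [b Hb] : exists b : tw_rep psi, realizes (@tw_rep_act _ _ psi) b
    (limg (op a 1 x)) (fun h => op a (sgval h) x).
  apply: tw_realizable => [h v _|v|h g v _].
  - by apply: dd_idem_mem; apply: subcent_conjV.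
  - exact: dd_idemE.
  - by rewrite dd_actM subcent_conjV eqxx transgressionE.
by exists (K0_class _ b), b.
Qed.

(** The description covers every realization of a class because it is applied later to spaces of
    functions. Exactness holds because e_x M is the image of a projection with which intertwiners
    commute. *)
Lemma restriction_additive : exists f : {additive Rep D -> tw_Rep psi},
  forall (V : vectType R[i]) U (r : G * G -> 'End(V)) u,
    dd_class U r u ->
    tw_class (r (1%g, x) @: U)%VS (fun h => r (sgval h, x)) (f u).
Proof.
have [phi Hphi] := choice restriction_class_ex.
have phi_ses a b c : alg_rep_ses a b c -> phi b = phi a + phi c.
  move=> [f [g [ef eg [kf fg gs]]]].
  have Ef s v : f (dd_act a s v) = dd_act b s (f v).
    by rewrite -[RHS]comp_lfunE -ef comp_lfunE.
  have Eg s v : g (dd_act b s v) = dd_act c s (g v).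
    by rewrite -[RHS]comp_lfunE -eg comp_lfunE.
  have gf v : g (f v) = 0.
    by apply/eqP; rewrite -memv_ker -fg memv_img ?memvf.
  apply: (has_class_ses (@tw_ses_intro _ _ psi) (f := f) (g := g)
    (Hphi a) (Hphi b) (Hphi c)) => /=.
  - by move=> h v _; rewrite Ef.
  - by move=> h v _; rewrite Eg.
  - by move=> v _ /eqP; rewrite -memv_ker kf memv0 => /eqP.
  - by move=> v /dd_idemE <-; rewrite Ef memv_img ?memvf.
  - by move=> v _; apply: gf.
  - move=> v /dd_idemE ve /eqP; rewrite -memv_ker -fg => /memv_imgP [u _ vE].
    (* Projecting the preimage [u] to e_x M does not change its image, since [v] is fixed by the
       projection. *)
    exists (op a 1 x u); first by rewrite memv_img ?memvf.
    by rewrite Ef -vE ve.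
  - rewrite -limg_comp eg limg_comp gs; congr lfun_img.
have [f Hf] := K0_lift phi_ses; exists f => V U r _ [a ra ->].
rewrite Hf; have [b [jb [pb [ib jpb pjb eb]]] ->] := Hphi a.
have [ja [pa [ia jpa pja ea]]] := ra.
exists b => //.
have -> : (r (1%g, x) @: U = ja @: limg (op a 1 x))%VS.
  rewrite -ia -!limg_comp; congr lfun_img; apply/lfunP => v.
  by rewrite !comp_lfunE ea.
apply: (realizes_trans (r1 := fun h => op a (sgval h) x) _ jpa).
  by exists jb, pb.
by move=> h v; apply: ea.
Qed.

End Restriction.

(** * Coinduction from a centralizer *)

Section Coinduction.
Variables (R : realType) (G : finGroupType) (w : cocycle3 R G) (x : G).
Local Notation D := (drinfeld_double w).
Local Notation beta := (dd_coef w).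
Local Notation psi := (transgression w x).
Local Notation Cx := [subg 'C[x]].
Implicit Types (b : tw_rep psi) (c d : Cx) (g h y z : G).

Lemma conj_subcentM c g : (x ^ (sgval c * g) = x ^ g)%g.
Proof. by rewrite conjgM subcent_conj. Qed.

Section Functions.
Variable V : vectType R[i].
Local Notation W := {ffun G -> V}.
Implicit Type phi : W.

(* [<h, y>] acts on [phi], seen as a function on [e_x D], by right
   multiplication of the argument [<g, x ^ g>] of [phi g]. *)
Definition translate_fun (s : G * G) phi : W :=
  [ffun g => if (s.2 ^ s.1^-1)%g == (x ^ g)%g
             then beta g s.1 s.2 *: phi (g * s.1)%g else 0].

Fact translate_linear s : linear (translate_fun s).
Proof.
move=> k phi phi'; apply/ffunP => g; rewrite !ffunE; case: ifP => _.
  by rewrite scalerDr !scalerA mulrC.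
by rewrite scaler0 addr0.
Qed.

HB.instance Definition _ s :=
  GRing.isLinear.Build R[i] W W *:%R (translate_fun s) (translate_linear s).

Definition translate s : 'End(W) := linfun (translate_fun s).

Lemma translateE h y phi g :
  translate (h, y) phi g =
  if (y ^ h^-1)%g == (x ^ g)%g then beta g h y *: phi (g * h)%g else 0.
Proof. by rewrite lfunE ffunE. Qed.

(** When the labels match, [dd_coefA] gives the scalar; otherwise the two support conditions cannot
    hold together. *)
Lemma translateM h y g z phi :
  translate (h, y) (translate (g, z) phi) =
  if y == (z ^ g^-1)%g then beta h g z *: translate ((h * g)%g, z) phi else 0.
Proof.
apply/ffunP => k; rewrite !translateE conj_eqV -conjgM.
have [->|ny] := eqVneq y (z ^ g^-1)%g.
  rewrite [RHS]ffunE translateE !conj_eqV -!conjgM !mulgA.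
  case: eqP => [zE|_]; last by rewrite scaler0.
  by rewrite !scalerA -dd_coefA mulrC.
rewrite ffunE; case: eqP => // yE; case: eqP => [zE|_]; last by rewrite scaler0.
by rewrite yE zE eqxx in ny.
Qed.

Lemma translate1 phi : \sum_y translate (1%g, y) phi = phi.
Proof.
apply/ffunP => g; rewrite sum_ffunE (bigD1 (x ^ g)%g) //= big1 => [|y yg].
  by rewrite translateE invg1 conjg1 eqxx mulg1 dd_coefg1 scale1r addr0.
by rewrite translateE invg1 conjg1 (negPf yg).
Qed.

End Functions.

Section Equivariant.
Variable b : tw_rep psi.
Local Notation V := 'cV[R[i]]_(tw_rep_dim b).
Local Notation W := {ffun G -> V}.
Local Notation rho := (@tw_rep_act _ _ psi b).
Implicit Type phi : W.

(** Written as a linear map so that the equivariant functions form a kernel, hence a subspace by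
    construction. *)
Definition equivariance_defect phi : {ffun Cx * G -> V} :=
  [ffun s => beta (sgval s.1) s.2 (x ^ s.2)%g *: phi (sgval s.1 * s.2)%g
             - rho s.1 (phi s.2)].

Fact equivariance_defect_linear : linear equivariance_defect.
Proof.
move=> k phi phi'; apply/ffunP => s; rewrite !ffunE [rho _ _]linearP /=.
by rewrite scalerDr scalerBr !scalerA [k * _]mulrC opprD addrACA.
Qed.

HB.instance Definition _ :=
  GRing.isLinear.Build R[i] W {ffun Cx * G -> V} *:%R equivariance_defect
    equivariance_defect_linear.

Definition coind : {vspace W} := lker (linfun equivariance_defect).

Lemma coindP phi :
  reflect (forall c g, beta (sgval c) g (x ^ g)%g *: phi (sgval c * g)%g
                       = rho c (phi g))
          (phi \in coind).
Proof.
rewrite memv_ker lfunE; apply: (iffP eqP) => [/ffunP E c g|E].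
  by have /eqP := E (c, g); rewrite !ffunE subr_eq0 => /eqP.
by apply/ffunP => -[c g]; rewrite !ffunE E subrr.
Qed.

Lemma tw_actM c d v : rho c (rho d v) = psi c d *: rho (c * d)%g v.
Proof. by rewrite -comp_lfunE tw_repM scale_lfunE. Qed.

(** Equivariance concerns multiplication on the left and translation multiplication on the right;
    [dd_coefA] makes them compatible. *)
Lemma translate_coind s : {in coind, forall phi, translate V s phi \in coind}.
Proof.
case: s => h y phi /coindP E; apply/coindP => c g; rewrite !translateE.
rewrite conj_subcentM; case: eqP => [yE|_]; last by rewrite scaler0 linear0.
rewrite [rho _ _]linearZ /= -mulgA -E !scalerA -yE -dd_coefA mulrC.
by rewrite conjgM -yE conjgKV.
Qed.

Lemma coind_class_ex : exists u : Rep D, dd_class coind (@translate V) u.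
Proof.
have [a Ha] : exists a : alg_rep D,
    realizes (@dd_act _ _ w) a coind (@translate V).
  apply: dd_realizable => [s|h y g z phi _|phi _].
  - exact: translate_coind.
  - exact: translateM.
  - exact: translate1.
by exists (K0_class _ a), a.
Qed.

(** This is the projection onto [coind] multiplied by the order of the centralizer, as
    [average_coind] and [average_id] show. *)
Definition average phi : W :=
  [ffun g => \sum_c (beta (sgval c) ((sgval c)^-1 * g)%g (x ^ g)%g)^-1
                      *: rho c (phi ((sgval c)^-1 * g)%g)].

Lemma average_coind phi : average phi \in coind.
Proof.
apply/coindP => d g; rewrite !ffunE scaler_sumr [rho _ _]linear_sum.
rewrite (reindex_inj (mulgI d)) /=; apply: eq_bigr => c _.
rewrite [rho d (_ *: _)]linearZ /= tw_actM !scalerA conj_subcentM.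
rewrite invMg -!mulgA mulKg.
congr (_ *: _); rewrite transgressionE.
set g' := (_^-1 * g)%g.
(* The scalars agree by associativity for d, c and g' = c^-1 g; one of its factors is psi(d, c)
   because (x ^ g) ^ g'^-1 = x. *)
have := dd_coefA w (sgval d) (sgval c) g' (x ^ g)%g.
have -> : ((x ^ g) ^ g'^-1 = x)%g.
  by rewrite -conjgM /g' invMg invgK mulgA mulgV mul1g subcent_conj.
rewrite {1}/g' mulKVg => E; rewrite [RHS]mulrC.
by apply/eqP; rewrite eqr_div ?dd_coef_neq0 // E.
Qed.

Lemma average_id : {in coind, forall phi, average phi = #|Cx|%:R *: phi}.
Proof.
move=> phi /coindP E; apply/ffunP => g; rewrite !ffunE.
transitivity (\sum_(c : Cx) phi g); last by rewrite sumr_const scaler_nat.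
apply: eq_bigr => c _; rewrite -E mulKVg scalerA.
have -> : (x ^ ((sgval c)^-1 * g) = x ^ g)%g by rewrite conjgM subcent_conjV.
by rewrite mulVf ?dd_coef_neq0 // scale1r.
Qed.

Lemma card_subcent_neq0 : #|Cx|%:R != 0 :> R[i].
Proof. by rewrite pnatr_eq0 -lt0n; apply/card_gt0P; exists 1%g. Qed.

End Equivariant.

Section PostComposition.
Variables (b1 b2 : tw_rep psi).
Local Notation V1 := 'cV[R[i]]_(tw_rep_dim b1).
Local Notation V2 := 'cV[R[i]]_(tw_rep_dim b2).
Variable f : 'Hom(V1, V2).

(** The action of coinduction on morphisms. *)
Definition post_fun (phi : {ffun G -> V1}) : {ffun G -> V2} :=
  [ffun g => f (phi g)].

Fact post_linear : linear post_fun.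
Proof. by move=> k phi phi'; apply/ffunP => g; rewrite !ffunE linearP. Qed.

HB.instance Definition _ :=
  GRing.isLinear.Build R[i] {ffun G -> V1} {ffun G -> V2} *:%R post_fun
    post_linear.

Definition post : 'Hom({ffun G -> V1}, {ffun G -> V2}) := linfun post_fun.

Lemma postE phi g : post phi g = f (phi g).
Proof. by rewrite lfunE ffunE. Qed.

Lemma post_translate s phi :
  post (translate V1 s phi) = translate V2 s (post phi).
Proof.
case: s => h y; apply/ffunP => g; rewrite postE !translateE postE.
by case: ifP => _; rewrite ?linearZ ?linear0.
Qed.

Hypothesis fE : intertwines (@tw_rep_act _ _ _ b1) (@tw_rep_act _ _ _ b2) f.

Let f_act (c : Cx) (v : V1) : f (tw_rep_act b1 c v) = tw_rep_act b2 c (f v).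
Proof. by rewrite -[RHS]comp_lfunE -fE comp_lfunE. Qed.

Lemma post_coind : {in coind b1, forall phi, post phi \in coind b2}.
Proof.
move=> phi /coindP E; apply/coindP => c g.
by rewrite !postE -f_act -E linearZ.
Qed.

Lemma post_average phi : post (average phi) = average (post phi).
Proof.
apply/ffunP => g; rewrite postE !ffunE linear_sum; apply: eq_bigr => c _.
by rewrite linearZ /= f_act postE.
Qed.

End PostComposition.

(** Exactness on the left and in the middle can be checked pointwise; surjectivity is where
    averaging enters. *)
Lemma coinduction_additive : exists f : {additive tw_Rep psi -> Rep D},
  forall b, dd_class (coind b) (@translate 'cV[R[i]]_(tw_rep_dim b))
              (f (K0_class _ b)).
Proof.
have [phi Hphi] := choice coind_class_ex.
have phi_ses (a b c : tw_rep psi) : tw_rep_ses a b c -> phi b = phi a + phi c.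
  move=> [f [g [ef eg [kf fg gs]]]].
  have gf v : g (f v) = 0.
    by apply/eqP; rewrite -memv_ker -fg memv_img ?memvf.
  have f0 v : f v = 0 -> v = 0.
    by move/eqP; rewrite -memv_ker kf memv0 => /eqP.
  apply: (has_class_ses (@dd_ses_intro _ _ w) (f := post f) (g := post g)
    (Hphi a) (Hphi b) (Hphi c)) => /=.
  - by move=> s u _; apply: post_translate.
  - by move=> s u _; apply: post_translate.
  - move=> u _ /ffunP E; apply/ffunP => k; rewrite ffunE; apply: f0.
    by have := E k; rewrite postE ffunE.
  - exact: post_coind.
  - by move=> u _; apply/ffunP => k; rewrite !postE gf ffunE.
  - move=> u /coindP uE /ffunP gu.
    have Eu k : f (f^-1%VF (u k)) = u k.
      apply: limg_lfunVK; rewrite fg memv_ker; apply/eqP.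
      by have := gu k; rewrite postE ffunE.
    (* Since [f] is injective, the pointwise preimage of an equivariant function is itself
       equivariant. *)
    pose u' : {ffun G -> 'cV[R[i]]_(tw_rep_dim a)} := [ffun k => f^-1%VF (u k)].
    have u'E : post f u' = u by apply/ffunP => k; rewrite postE ffunE Eu.
    exists u' => //; apply/coindP => d k.
    have fI : injective f by apply/lker0P; rewrite kf.
    apply: fI; rewrite linearZ /= !ffunE Eu uE.
    by rewrite -[RHS]comp_lfunE ef comp_lfunE Eu.
  - apply/vspaceP => u; apply/memv_imgP/idP => [[v vU ->]|uU].
      exact: post_coind.
    have Eu k : g (g^-1%VF (u k)) = u k.
      by apply: limg_lfunVK; rewrite gs memvf.
    pose u' : {ffun G -> 'cV[R[i]]_(tw_rep_dim b)} := [ffun k => g^-1%VF (u k)].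
    have u'E : post g u' = u by apply/ffunP => k; rewrite postE ffunE Eu.
    (* The pointwise lift [u'] need not be equivariant. Its normalized average is, and still maps to
       [u], because [post g] commutes with averaging and [u] is already equivariant. *)
    exists ((#|Cx|%:R)^-1 *: average u').
      by rewrite memvZ // average_coind.
    rewrite linearZ /= post_average // u'E average_id // scalerA.
    rewrite mulVf ?scale1r //.
    exact: card_subcent_neq0.
have [f Hf] := K0_lift phi_ses; exists f => b.
by rewrite Hf; apply: Hphi.
Qed.

End Coinduction.

(** * Mutual inverses *)

Section Composites.
Variables (R : realType) (G : finGroupType) (w : cocycle3 R G) (x : G).
Local Notation D := (drinfeld_double w).
Local Notation beta := (dd_coef w).
Local Notation psi := (transgression w x).
Local Notation Cx := [subg 'C[x]].
Local Notation op a g y := (dd_act a (g%g, y%g)).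
Implicit Types (b : tw_rep psi) (c d : Cx) (g h y z : G).

Lemma conj_eq_subcent g : (x == x ^ g)%g = (g \in 'C[x])%g.
Proof.
rewrite conjgE; apply/eqP/cent1P => [E|gx].
  by rewrite /commute {1}E mulKVg.
by rewrite -gx mulKg.
Qed.

(** The idempotent e_x cuts a function down to C_x, where an equivariant function is determined by
    its value at 1. Evaluation at 1 is therefore the required isomorphism. *)
Lemma restriction_coinduction b (u : tw_Rep psi) :
  tw_class (translate w x 'cV[R[i]]_(tw_rep_dim b) (1%g, x) @: coind b)%VS
    (fun c => translate w x 'cV[R[i]]_(tw_rep_dim b) (sgval c, x)) u ->
  u = K0_class _ b.
Proof.
set V := 'cV[R[i]]_(tw_rep_dim b); pose M := translate w x V => Hu.
have M1E (phi : {ffun G -> V}) g :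
    M (1%g, x) phi g = if (g \in 'C[x])%g then phi g else 0.
  rewrite translateE invg1 conjg1 conj_eq_subcent mulg1.
  by rewrite dd_coefg1 scale1r.
have phiE (phi : {ffun G -> V}) c :
    phi \in coind b -> phi (sgval c) = tw_rep_act b c (phi 1%g).
  move=> /coindP /(_ c 1%g) <-.
  by rewrite mulg1 dd_coefg1 scale1r.
have evl : linear (fun phi : {ffun G -> V} => phi 1%g).
  by move=> k phi phi'; rewrite !ffunE.
pose eva := GRing.isLinear.Build _ _ _ _ _ evl.
pose ev := linfun (HB.pack (fun phi : {ffun G -> V} => phi 1%g) eva :
  {linear {ffun G -> V} -> V}).
have evE phi : ev phi = phi 1%g by rewrite lfunE.
apply: (has_class_iso (@tw_ses_intro _ _ psi) (@tw_zero_realizable _ _ psi)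
  (f := ev) Hu (has_class_self (@tw_rep_act _ _ psi) _ b)).
- move=> h _ /memv_imgP [phi phiU ->]; rewrite !evE translateE.
  rewrite subcent_conjV conjg1 eqxx mul1g dd_coef1g scale1r.
  by rewrite phiE // translate_coind.
- move=> _ /memv_imgP [phi phiU ->]; rewrite evE M1E group1 => E.
  apply/ffunP => g; rewrite M1E [RHS]ffunE; case: ifP => // gC.
  by rewrite -(subgK _ gC) phiE // E linear0.
- apply/vspaceP => v; rewrite memvf; apply/memv_imgP.
  (* The preimage of [v] is c |-> c . v, extended by zero outside C_x. *)
  pose phi : {ffun G -> V} :=
    [ffun g => if (g \in 'C[x])%g then tw_rep_act b (subg 'C[x] g)%g v else 0].
  have phi1 : phi 1%g = v.
    have E : subg 'C[x]%G 1%g = 1%g := sgvalK (1%g : Cx).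
    by rewrite ffunE group1 E tw_rep1 id_lfunE.
  have phiU : phi \in coind b.
    apply/coindP => c g; rewrite !ffunE groupMl ?(valP c) //.
    case: ifP => gC; last by rewrite scaler0 linear0.
    rewrite tw_actM transgressionE subgK //.
    have -> : (subg 'C[x] (sgval c * g) = c * subg 'C[x] g)%g.
      by rewrite -[RHS]sgvalK /= subgK.
    by move: gC; rewrite -conj_eq_subcent => /eqP <-.
  exists (M (1%g, x) phi); first by rewrite memv_img.
  by rewrite evE M1E group1 phi1.
Qed.

(** No g satisfies z = x ^ g, so e_z annihilates every function. *)
Lemma restriction_coinduction0 (V : vectType R[i]) (U : {vspace {ffun G -> V}})
    z (u : tw_Rep (transgression w z)) :
  z \notin (x ^: [set: G])%g ->
  tw_class (translate w x V (1%g, z) @: U)%VS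
    (fun k => translate w x V (sgval k, z)) u -> u = 0.
Proof.
move=> zx.
have -> : (translate w x V (1%g, z) @: U = 0)%VS.
  apply/eqP; rewrite -subv0; apply/subvP => _ /memv_imgP [phi _ ->].
  rewrite memv0; apply/eqP/ffunP => g; rewrite translateE [RHS]ffunE.
  rewrite invg1 conjg1; case: eqP => // zE; case/negP: zx.
  by apply/imsetP; exists g.
exact: (has_class0 (@tw_ses_intro _ _ _)).
Qed.

End Composites.

(** * The part of a representation supported on one conjugacy class *)

Section ClassComponent.
Variables (R : realType) (G : finGroupType) (w : cocycle3 R G).
Variable a : alg_rep (drinfeld_double w).
Local Notation beta := (dd_coef w).
Local Notation op g y := (dd_act a (g%g, y%g)).
Local Notation Va := 'cV[R[i]]_(alg_rep_dim a).
Implicit Types (x g h y z k : G).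

(** The action of the central idempotent attached to the class of [x]. *)
Definition class_proj x : 'End(Va) := \sum_(z in (x ^: [set: G])%g) op 1 z.

Lemma class_projE x v :
  class_proj x v = \sum_(z in (x ^: [set: G])%g) op 1 z v.
Proof. by rewrite /class_proj sum_lfunE. Qed.

(** The image of [op g y] lies in the summand of y ^ g^-1, which is conjugate to y. *)
Lemma class_proj_act x g y v :
  class_proj x (op g y v) =
  if y \in (x ^: [set: G])%g then op g y v else 0.
Proof.
rewrite class_projE; have E z : op 1 z (op g y v) =
    if z == (y ^ g^-1)%g then op g y v else 0.
  by rewrite dd_actM dd_coef1g scale1r mul1g.
have N : (y \in x ^: [set: G])%g = (y ^ g^-1 \in x ^: [set: G])%g.
  by rewrite memJ_norm // (subsetP (class_norm x [set: G])) ?inE.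
rewrite N (eq_bigr _ (fun z _ => E z)) -big_mkcondr /=; case: ifP => yx.
  rewrite (big_pred1 (y ^ g^-1)%g) // => z /=.
  by case: eqP => [->|]; rewrite ?yx ?andbF.
by rewrite big_pred0 // => z; case: eqP => [->|]; rewrite ?yx ?andbF.
Qed.

Lemma act_class_proj x g y v :
  op g y (class_proj x v) =
  if y \in (x ^: [set: G])%g then op g y v else 0.
Proof.
rewrite class_projE linear_sum /=.
have E z : op g y (op 1 z v) = if z == y then op g y v else 0.
  rewrite dd_actM invg1 conjg1 dd_coefg1 scale1r mulg1 eq_sym.
  by case: eqP => [->|].
rewrite (eq_bigr _ (fun z _ => E z)) -big_mkcondr /=; case: ifP => yx.
  by rewrite (big_pred1 y) // => z /=; case: eqP => [->|]; rewrite ?yx ?andbF.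
by rewrite big_pred0 // => z; case: eqP => [->|]; rewrite ?yx ?andbF.
Qed.

Lemma class_projC x s v :
  class_proj x (dd_act a s v) = dd_act a s (class_proj x v).
Proof. by case: s => g y; rewrite class_proj_act act_class_proj. Qed.

Lemma class_proj_id x v : class_proj x (class_proj x v) = class_proj x v.
Proof.
rewrite (class_projE x v) linear_sum; apply: eq_bigr => z zx /=.
by rewrite class_proj_act zx.
Qed.

Lemma class_proj_orth x y v :
  x \notin (y ^: [set: G])%g -> class_proj x (class_proj y v) = 0.
Proof.
move=> xy; rewrite (class_projE y) linear_sum big1 // => z zy /=.
rewrite class_proj_act; case: ifP => // zx; case/negP: xy.
by rewrite -(class_eqP zy) (class_eqP zx) class_refl.
Qed.

(** The elements k in question form the right coset C_x h. *)
Lemma card_conj_eq x h : #|[pred k | (x ^ h == x ^ k)%g]| = #|'C[x]%g|.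
Proof.
rewrite -(card_rcoset _ h); apply: eq_card => k; rewrite mem_rcoset inE /=.
rewrite -conj_eq_subcent conjgM eq_sym -[in RHS](inj_eq (conjg_inj h)) conjgKV.
by rewrite eq_sym.
Qed.

(** Applied to the projections onto single classes and also to their partial sums, as
    [has_class_sum] requires. *)
Lemma commuting_limg_class_ex (e : 'End(Va)) :
  (forall s v, e (dd_act a s v) = dd_act a s (e v)) ->
  exists u : Rep (drinfeld_double w), dd_class (w := w) (limg e) (dd_act a) u.
Proof.
move=> ec; have [b Hb] : exists b : alg_rep (drinfeld_double w),
    realizes (@dd_act _ _ w) b (limg e) (dd_act a).
  apply: dd_realizable => [s _ /memv_imgP [v _ ->]|h y g x v _|v _].
  - by rewrite -ec memv_img ?memvf.
  - exact: dd_actM.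
  - exact: dd_act1.
by exists (K0_class _ b), b.
Qed.

Lemma coinduction_restriction x (b : tw_rep (transgression w x)) u u' :
  realizes (@tw_rep_act _ _ (transgression w x)) b (limg (op 1 x))
    (fun c => op (sgval c) x : 'End(Va)) ->
  dd_class (w := w) (coind b) (translate w x 'cV[R[i]]_(tw_rep_dim b)) u ->
  dd_class (w := w) (limg (class_proj x)) (dd_act a) u' -> u' = u.
Proof.
move=> [j [p [ij jp pj je]]] Hu Hu'.
set V := 'cV[R[i]]_(tw_rep_dim b) in j p ij jp pj je Hu *.
have conjK k : ((x ^ k) ^ k^-1 = x)%g by rewrite conjgK.
have xV k : (x ^ k^-1^-1 = x ^ k)%g by rewrite invgK.
have opx k v : op k (x ^ k) v \in limg (op 1 x) by apply: dd_idem_mem.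
(* [Phi] and [Psi] are inverse to each other up to the factor #|C_x|. *)
pose Phi0 (m : Va) : {ffun G -> V} := [ffun k => p (op k (x ^ k) m)].
have Phil : linear Phi0.
  by move=> k m m'; apply/ffunP => g; rewrite !ffunE !linearP.
pose Phia := GRing.isLinear.Build _ _ _ _ _ Phil.
pose Phi := linfun (HB.pack Phi0 Phia : {linear Va -> {ffun G -> V}}).
have PhiE m k : Phi m k = p (op k (x ^ k) m) by rewrite lfunE ffunE.
(* The scalar cancels the structure constant in <k^-1, x> <k, x^k> = beta(k^-1, k, x^k) <1, x^k>. *)
pose Psi (phi : {ffun G -> V}) : Va :=
  \sum_k (beta k^-1%g k (x ^ k)%g)^-1 *: op k^-1 x (j (phi k)).
pose N : R[i] := #|'C[x]%g|%:R.
have N0 : N != 0 by rewrite pnatr_eq0 -lt0n cardG_gt0.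
have PsiPhi m : Psi (Phi m) = N *: class_proj x m.
  rewrite /Psi class_projE scaler_sumr.
  (* Grouping the k by the conjugate x ^ k, each conjugate occurs as often as C_x has elements. *)
  rewrite (partition_big (fun k => x ^ k)%g (mem (x ^: [set: G])%g)) /=;
    last first.
    by move=> k _; apply/imsetP; exists k; rewrite ?inE.
  apply: eq_bigr => _ /imsetP [h _ ->].
  rewrite (eq_bigr (fun=> op 1 (x ^ h) m)) => [|k /eqP kh].
    rewrite sumr_const -scaler_nat /N -(card_conj_eq x h).
    by congr (_%:R *: _); apply: eq_card => k; rewrite !inE eq_sym.
  rewrite PhiE pj // dd_actM conjK eqxx mulVg kh scalerA mulVf ?scale1r //.
  exact: dd_coef_neq0.
have PhiPsi : {in coind b, forall phi, Phi (Psi phi) = N *: phi}.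
  move=> phi /coindP E; apply/ffunP => h.
  rewrite PhiE /Psi linear_sum linear_sum.
  (* Only the k with x ^ k = x ^ h survive; then h k^-1 lies in C_x, and equivariance together with
     associativity for h, k^-1, k turns the term into phi(h). *)
  transitivity (\sum_(k | (x ^ h == x ^ k)%g) phi h).
    rewrite [RHS]big_mkcond /=; apply: eq_bigr => k _.
    rewrite !linearZ /= dd_actM xV; case: eqP => [hk|_]; last first.
      by rewrite linear0 scaler0.
    have cC : (h * k^-1 \in 'C[x])%g.
      by rewrite -conj_eq_subcent conjgM hk conjK.
    pose c := subg 'C[x]%G (h * k^-1)%g.
    have cE : sgval c = (h * k^-1)%g by apply: subgK.
    rewrite [p _]linearZ /= -cE -je jp -E cE mulgKV !scalerA -mulrA.
    have := dd_coefA w h k^-1%g k (x ^ k)%g.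
    rewrite mulVg dd_coefg1 mul1r conjK => <-.
    by rewrite mulVf ?scale1r // dd_coef_neq0.
  by rewrite sumr_const card_conj_eq ffunE scaler_nat.
apply: (has_class_iso (@dd_ses_intro _ _ w) (@dd_zero_realizable _ _ w)
  (f := Phi) Hu' Hu).
- move=> [h y] m _; apply/ffunP => k; rewrite PhiE translateE dd_actM PhiE.
  rewrite [in RHS]eq_sym; case: eqP => [xk|_]; last by rewrite linear0.
  by rewrite linearZ conjgM xk conjgKV.
- move=> _ /memv_imgP [m _ ->] E; have := PsiPhi (class_proj x m).
  rewrite class_proj_id E /Psi big1 => [/esym/eqP|k _]; last first.
    by rewrite ffunE !linear0 ?scaler0.
  by rewrite scaler_eq0 (negPf N0) => /eqP.
- apply/vspaceP => phi; apply/memv_imgP/idP => [[m _ ->]|phiU].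
    apply/coindP => c g; rewrite !PhiE conj_subcentM.
    rewrite -[RHS]jp je pj // dd_actM conjK eqxx.
    by rewrite !linearZ.
  exists (N^-1 *: Psi phi); last first.
    by rewrite linearZ /= PhiPsi // scalerA mulVf // scale1r.
  apply/memvZ/memv_suml => k _; apply: memvZ; apply/memv_imgP.
  exists (op k^-1 x (j (phi k))); rewrite ?memvf // class_proj_act.
  by rewrite class_refl.
Qed.

End ClassComponent.

(** * Assembling the components over a transversal of the classes *)

Lemma transversal_mem (G : finGroupType) (X : {set G}) (z : G) :
  is_transversal X (classes [set: G]) [set: G] ->
  exists2 x, x \in X &
    forall y, y \in X -> (z \in y ^: [set: G])%g = (y == x).
Proof.
move=> /and3P [_ _ /forall_inP H].
have /cards1P [x Xx] : #|(z ^: [set: G])%g :&: X| == 1%N.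
  by rewrite setIC; apply: H; rewrite mem_classes ?inE.
exists x => [|y yX].
  by have := set11 x; rewrite -Xx inE => /andP [].
by rewrite class_sym -[RHS]in_set1 -Xx inE yX andbT.
Qed.

Theorem theorem19 (R : realType) (G : finGroupType) (w : cocycle3 R G)
    (X : {set G})
    (HX : is_transversal X (classes [set: G]) [set: G]) :
  exists f : {additive Rep (drinfeld_double w) ->
               dsum (fun x : {x : G | x \in X} =>
                       tw_Rep (transgression w (val x)))},
    bijective f.
Proof.
pose I : finType := {x : G | x \in X}.
pose res (i : I) := sval (cid (restriction_additive w (val i))).
pose ind (i : I) := sval (cid (coinduction_additive w (val i))).
have resP (k : I) (V : vectType R[i]) (U : {vspace V})
    (r : G * G -> 'End(V)) u :
    dd_class (w := w) U r u ->
    tw_class (psi := transgression w (val k)) (r (1%g, val k) @: U)%VS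
      (fun c => r (sgval c, val k)) (res k u).
  by rewrite /res; case: cid => f /= fP; apply: fP.
have indP (k : I) (b : tw_rep (transgression w (val k))) :
    dd_class (coind b) (translate w (val k) 'cV[R[i]]_(tw_rep_dim b))
      (ind k (K0_class _ b)).
  by rewrite /ind; case: cid => f /= fP; apply: fP.
have uniq_class z : exists x : I,
    forall y : I, (z \in val y ^: [set: G])%g = (y == x).
  have [x xX Hx] := transversal_mem z HX.
  by exists (Sub x xX) => y; rewrite Hx ?(valP y).
have disj (i k : I) : i != k -> (val i \notin val k ^: [set: G])%g.
  have [x Hx] := uniq_class (val i); rewrite Hx.
  by have := Hx i; rewrite class_refl => /esym/eqP <-; rewrite eq_sym.
have resind i : cancel (ind i) (res i).
  apply: (K0_ext (f := res i \o ind i) (g := idfun)) => b /=.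
  by apply: restriction_coinduction; apply: resP; apply: indP.
have resind0 i k u : i != k -> res k (ind i u) = 0.
  move=> ik; move: u; apply: (K0_ext (f := res k \o ind i) (g := \0)) => b /=.
  have ki : (val k \notin val i ^: [set: G])%g by apply: disj; rewrite eq_sym.
  by apply: (restriction_coinduction0 ki); apply: resP; apply: indP.
have indres u : \sum_i ind i (res i u) = u.
  (* The sum is packaged as an additive map so that [K0_ext] reduces the identity to the class of a
     single representation. *)
  pose s (v : Rep (drinfeld_double w)) := \sum_i ind i (res i v).
  have sB : zmod_morphism s.
    by move=> v v'; rewrite /s -sumrB; apply: eq_bigr => i _; rewrite !raddfB.
  pose sa := GRing.isZmodMorphism.Build _ _ s sB.
  apply: (K0_ext (f := HB.pack s sa : {additive Rep (drinfeld_double w) -> _})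
    (g := idfun)) => a /=.
  have cls i : dd_class (w := w) (limg (class_proj a (val i))) (dd_act a)
      (ind i (res i (K0_class _ a))).
    have [b Hb ->] := resP i _ _ _ _ (has_class_self (@dd_act _ _ w) _ a).
    have [u' Hu'] := commuting_limg_class_ex (@class_projC _ _ w a (val i)).
    by rewrite -(coinduction_restriction Hb (indP i b) Hu').
  symmetry; apply: (has_class_sum (@dd_ses_intro _ _ w)
    (r := dd_act a) (t := index_enum I)
    (e := fun i => class_proj a (val i))
    (u := fun i => ind i (res i (K0_class _ a)))).
  - exact: index_enum_uniq.
  - by move=> i v y; apply: class_projC.
  - by move=> i v; apply: class_proj_id.
  - by move=> i k v ik; apply: class_proj_orth; apply: disj.
  - by move=> i _; apply: cls.
  - move=> t; apply: commuting_limg_class_ex => v y.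
    rewrite !sum_lfunE linear_sum; apply: eq_bigr => i _; exact: class_projC.
  (* Each group element is conjugate to exactly one member of the transversal, so the class
     projections add up to the identity. *)
  - suff -> : \sum_(i : I) class_proj a (val i) = \1%VF.
      rewrite (fixedSpace_limg _); first exact: has_class_self.
      by rewrite fixedSpace_id.
    apply/lfunP => v; rewrite id_lfunE -[RHS](dd_act1 v) sum_lfunE.
    under eq_bigr do rewrite class_projE big_mkcond.
    rewrite exchange_big; apply: eq_bigr => z _ /=.
    have [x Hx] := uniq_class z.
    by rewrite -big_mkcond (big_pred1 x).
pose A (i : I) := tw_Rep (transgression w (val i)).
have dsumD (v v' : dsum A) i : (v + v') i = v i + v' i by rewrite [LHS]ffunE.
have dsumN (v : dsum A) i : (- v) i = - v i by rewrite [LHS]ffunE.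
pose F (u : Rep (drinfeld_double w)) : dsum A := [ffun i => res i u].
have FB : zmod_morphism F.
  move=> u v; apply/ffunP => i.
  by rewrite dsumD dsumN !ffunE raddfB.
pose Fa := GRing.isZmodMorphism.Build _ _ F FB.
exists (HB.pack F Fa : {additive Rep (drinfeld_double w) -> dsum A}).
(* The inverse adds up the coinductions; in the second composite [resind0] removes all terms off the
   diagonal. *)
exists (fun v : dsum A => \sum_i ind i (v i)) => [u|v] /=.
  by rewrite -[RHS]indres; apply: eq_bigr => i _; rewrite ffunE.
apply/ffunP => i; rewrite ffunE raddf_sum (bigD1 i) //= resind.
by rewrite big1 ?addr0 // => k ki; apply: resind0.
Qed.
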